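(* Let $X=\ell^{2}$ (the real Hilbert space of square-summable sequences $x=(x_n)_{n\ge 1}$), let $P=\ell^2_+=\{x=(x_n)\in \ell^2:\ x_n\ge 0\ \forall n\geq 1\}$, and let $$K=\{x=(x_n)\in B_X:\ x_1+x_n^2\leq 0\ \ \forall n\geq 2\}.$$ Then $$\mathrm{Max}(K,P)\cap U_X=\{0\}\quad\text{and}\quad \mathrm{StMax}(K,P)\cap U_X=\mathrm{Pos}(K,P)\cap U_X=\emptyset.$$
   Context: For a real Banach space $X$, $B_X$ is the closed unit ball and $U_X$ the open unit ball. For a closed convex cone $P\subset X$, the set of strictly positive functionals is $$\mathrm{inn}\,P^{*}=\{f\in X^*:\ f(u)>0\ \ \forall u\in P\setminus\{0\}\}.$$ For a nonempty set $K\subset X$ define: - maximal elements: $\mathrm{Max}(K,P)=\{x\in K:\ \{x\}=K\cap(x+P)\}$; - positive elements: $\mathrm{Pos}(K,P)=\{x\in K:\ \exists f\in\mathrm{inn}\,P^{*},\ f(x)=\sup f(K)\}$; - strictly maximal elements: $\mathrm{StMax}(K,P)=\{x\in K:\ \forall\varepsilon>0\ \exists\delta>0,\ (P+\delta B_X)\cap(K-x)\subset\varepsilon B_X\}$. *)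

(* Defs.v *)
From HB Require Import structures.
From mathcomp Require Import all_boot all_order all_algebra.
From mathcomp Require Import boolp classical_sets functions reals ereal.
From mathcomp Require Import topology normedtype sequences ring lra.

Set Implicit Arguments.
Unset Strict Implicit.
Unset Printing Implicit Defensive.

Import Order.TTheory GRing.Theory Num.Theory.
Import numFieldNormedType.Exports.

Local Open Scope classical_set_scope.
Local Open Scope ring_scope.

Section Maximality.
Context {R : realType} {X : completeNormedModType R}.
Implicit Types (P K : set X).

(* The dual of [X] is the type of continuous linear maps [X -> R]. *)
Definition inn_dual P : set {linear X -> R} :=
  [set f : {linear X -> R} | continuous f /\ forall u, P u -> u != 0 -> 0 < f u].

Definition Max K P : set X :=
  [set x | K x /\ [set x] = K `&` [set x + p | p in P]].

(* The supremum is taken in the extended reals, so that it is [+oo], and not a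
   default value, when [f] is unbounded above on [K]. *)
Definition Pos K P : set X :=
  [set x | K x /\ exists2 f : {linear X -> R}, inn_dual P f &
     (f x)%:E = ereal_sup [set (f y)%:E | y in K]].

Definition StMax K P : set X :=
  [set x | K x /\ forall eps : R, 0 < eps -> exists2 delta : R, 0 < delta &
     [set p + delta *: b | p in P & b in closed_ball (0 : X) 1]
       `&` [set y - x | y in K]
     `<=` [set eps *: b | b in closed_ball (0 : X) 1]].

End Maximality.

Section SquareSummable.
Context {R : realType}.
Implicit Types (u v : nat -> R).

Definition square_summable : {pred nat -> R} :=
  [pred u : nat -> R | `[< cvgn (series (fun n => u n ^+ 2)) >]].

Definition ell2_norm u : R := Num.sqrt (limn (series (fun n => u n ^+ 2))).

Let S n u := series (fun k => u k ^+ 2) n.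

Let S_nd u : {homo (fun n => S n u) : n m / (n <= m)%N >-> n <= m}.
Proof.
by apply/nondecreasing_seqP => n; rewrite /S seriesSr lerDl sqr_ge0.
Qed.

Let S_ge0 n u : 0 <= S n u.
Proof. by rewrite /S /series /= sumr_ge0 // => i _; exact: sqr_ge0. Qed.

Let S_lim u : u \in square_summable ->
  (fun n => S n u) @ \oo --> limn (series (fun n => u n ^+ 2)).
Proof. by move=> /asboolP. Qed.

Let lim_ge0 u : u \in square_summable ->
  0 <= limn (series (fun n => u n ^+ 2)).
Proof.
move=> us; apply: limr_ge; first exact/asboolP.
by apply: nearW => n; exact: (S_ge0 n u).
Qed.

Lemma partial_le_ell2_norm u n : u \in square_summable ->
  Num.sqrt (series (fun k => u k ^+ 2) n) <= ell2_norm u.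
Proof.
move=> us; rewrite ler_sqrt ?lim_ge0 //.
by apply: nondecreasing_cvgn_le; [exact: S_nd | exact/asboolP].
Qed.

Lemma square_summable_le u M : 0 <= M ->
  (forall n, series (fun k => u k ^+ 2) n <= M ^+ 2) ->
  u \in square_summable /\ ell2_norm u <= M.
Proof.
move=> M0 uM.
have us : u \in square_summable.
  apply/asboolP; apply: nondecreasing_is_cvgn; first exact: S_nd.
  by exists (M ^+ 2) => _ [n _ <-]; exact: uM.
split => //; rewrite -(ger0_norm M0) -sqrtr_sqr ler_sqrt ?sqr_ge0 //.
apply: limr_le; first exact/asboolP.
by apply: nearW => n; exact: uM.
Qed.

Let minkowski2 (a b x y : R) : 0 <= a -> 0 <= b ->
  Num.sqrt ((a + b) ^+ 2 + (x + y) ^+ 2) <=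
  Num.sqrt (a ^+ 2 + x ^+ 2) + Num.sqrt (b ^+ 2 + y ^+ 2).
Proof.
move=> a0 b0.
set p := Num.sqrt (a ^+ 2 + x ^+ 2); set q := Num.sqrt (b ^+ 2 + y ^+ 2).
have p0 : 0 <= p by exact: sqrtr_ge0.
have q0 : 0 <= q by exact: sqrtr_ge0.
have p2 : p ^+ 2 = a ^+ 2 + x ^+ 2 by rewrite sqr_sqrtr // addr_ge0 ?sqr_ge0.
have q2 : q ^+ 2 = b ^+ 2 + y ^+ 2 by rewrite sqr_sqrtr // addr_ge0 ?sqr_ge0.
rewrite -(ger0_norm (addr_ge0 p0 q0)) -sqrtr_sqr ler_sqrt ?sqr_ge0 //.
suff : a * b + x * y <= p * q by nra.
apply: le_trans (ler_norm _) _.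
rewrite -(@ler_pXn2r _ 2) ?nnegrE ?normr_ge0 ?mulr_ge0 //.
rewrite real_normK ?num_real // exprMn p2 q2.
rewrite -subr_ge0 (_ : _ - _ = (a * y - b * x) ^+ 2) ?sqr_ge0 //; ring.
Qed.

Let minkowski_partial u v n :
  Num.sqrt (S n (u + v)) <= Num.sqrt (S n u) + Num.sqrt (S n v).
Proof.
elim: n => [|n IH]; first by rewrite /S /series /= !big_geq // sqrtr0 addr0.
have E w : S n.+1 w = Num.sqrt (S n w) ^+ 2 + w n ^+ 2.
  by rewrite sqr_sqrtr // /S seriesSr.
rewrite !E; apply: le_trans (minkowski2 (u n) (v n) (sqrtr_ge0 _) (sqrtr_ge0 _)).
rewrite ler_sqrt ?addr_ge0 ?sqr_ge0 // lerD2r.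
by rewrite ler_pXn2r // nnegrE ?addr_ge0 // sqrtr_ge0.
Qed.

Lemma ell2_norm_ge0 u : 0 <= ell2_norm u.
Proof. exact: sqrtr_ge0. Qed.

Let add_aux u v : u \in square_summable -> v \in square_summable ->
  (u + v) \in square_summable /\ ell2_norm (u + v) <= ell2_norm u + ell2_norm v.
Proof.
move=> us vs; apply: square_summable_le.
  by rewrite addr_ge0 // ell2_norm_ge0.
move=> n; rewrite -[leLHS]sqr_sqrtr; last exact: (S_ge0 n (u + v)).
rewrite ler_pXn2r ?nnegrE ?sqrtr_ge0 ?addr_ge0 ?ell2_norm_ge0 //.
apply: le_trans (minkowski_partial u v n) _.
by rewrite lerD // partial_le_ell2_norm.
Qed.

Let scale_S (a : R) u : series (fun n => (a *: u) n ^+ 2) =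
  (fun n => a ^+ 2 * series (fun k => u k ^+ 2) n).
Proof.
apply/funext => n; rewrite /series /= mulr_sumr; apply: eq_bigr => i _.
by rewrite -exprMn.
Qed.

Let scale_aux (a : R) u : u \in square_summable ->
  (a *: u) \in square_summable /\ ell2_norm (a *: u) = `|a| * ell2_norm u.
Proof.
move=> us.
have c : series (fun n => (a *: u) n ^+ 2) @ \oo -->
    a ^+ 2 * limn (series (fun n => u n ^+ 2)).
  by rewrite scale_S; apply: cvgMr; exact: S_lim.
split; first by apply/asboolP; exact: cvgP c.
rewrite /ell2_norm (cvg_lim _ c) //.
by rewrite sqrtrM ?sqr_ge0 // sqrtr_sqr.
Qed.

Lemma square_summable_submod_closed : submod_closed square_summable.
Proof.
split.
  by apply: (proj1 (@square_summable_le 0 0 (lexx _) _)) => n;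
     rewrite /series /= big1 ?expr0n // => i _; rewrite expr0n.
move=> a u v us vs.
by case: (add_aux (proj1 (scale_aux a us)) vs).
Qed.

HB.instance Definition _ :=
  GRing.isSubmodClosed.Build R (nat -> R) square_summable
    square_summable_submod_closed.

Lemma ell2_normD u v : u \in square_summable -> v \in square_summable ->
  ell2_norm (u + v) <= ell2_norm u + ell2_norm v.
Proof. by move=> us vs; case: (add_aux us vs). Qed.

Lemma ell2_normZ (a : R) u : u \in square_summable ->
  ell2_norm (a *: u) = `|a| * ell2_norm u.
Proof. by move=> us; case: (scale_aux a us). Qed.

Lemma le_coord_ell2_norm u n : u \in square_summable -> `|u n| <= ell2_norm u.
Proof.
move=> us; apply: le_trans (partial_le_ell2_norm n.+1 us).
rewrite -sqrtr_sqr ler_sqrt ?(S_ge0 n.+1 u) //.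
by rewrite seriesSr lerDr (S_ge0 n u).
Qed.

End SquareSummable.

(* The coordinates x_1, x_2, x_3, ... of [x : ell2 R] are [x 0], [x 1], [x 2],
   and so on: the index is shifted by one. *)
Record ell2 (R : realType) := Ell2 {
  ell2_seq :> nat -> R;
  ell2_seqP : ell2_seq \in square_summable }.

Section Ell2Banach.
Context {R : realType}.

HB.instance Definition _ := [isSub for @ell2_seq R].
HB.instance Definition _ := [Choice of ell2 R by <:].
HB.instance Definition _ := [SubChoice_isSubLmodule of ell2 R by <:].

Let nrm (x : ell2 R) : R := ell2_norm x.

Let nrmD (x y : ell2 R) : nrm (x + y) <= nrm x + nrm y.
Proof. by apply: ell2_normD; exact: ell2_seqP. Qed.

Let nrmZ (a : R) (x : ell2 R) : nrm (a *: x) = `|a| * nrm x.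
Proof. by apply: ell2_normZ; exact: ell2_seqP. Qed.

Let nrm0_eq0 (x : ell2 R) : nrm x = 0 -> x = 0.
Proof.
move=> x0; apply/val_inj/funext => n /=.
apply/eqP; rewrite -normr_le0 -x0.
by apply: le_coord_ell2_norm; exact: ell2_seqP.
Qed.

HB.instance Definition _ :=
  Lmodule_isNormed.Build R (ell2 R) nrmD nrmZ nrm0_eq0.

Lemma ell2_normE (x : ell2 R) :
  `|x| = Num.sqrt (limn (series (fun n => x n ^+ 2))).
Proof. by []. Qed.

Lemma ell2_complete (F : set_system (ell2 R)) :
  ProperFilter F -> cauchy F -> cvg F.
Proof.
move=> FF /cauchy_ballP FC.
have coord_cvg n : cvg ((fun x : ell2 R => x n) @ F).
  apply: R_complete; apply/cauchy_ballP => e e0.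
  have := FC _ e0; rewrite !near_simpl; move=> [] [A B] [/= FA FB] AB.
  exists ((fun x : ell2 R => x n) @` A, (fun x : ell2 R => x n) @` B) => /=.
    by split; [apply: filterS FA|apply: filterS FB] => x Ax; exists x.
  move=> [_ _] /= [[x Ax <-] [y By <-]].
  have := AB (x, y) (conj Ax By).
  rewrite -!ball_normE /ball_ /=; apply: le_lt_trans.
  exact: (@le_coord_ell2_norm _ _ n (ell2_seqP (x - y))).
pose l n : R := lim ((fun x : ell2 R => x n) @ F).
have near_l (e : R) : 0 < e ->
    \forall x \near F, (ell2_seq x - l) \in square_summable /\
                       ell2_norm (ell2_seq x - l) <= e.
  move=> e0; have := FC _ e0; rewrite !near_simpl => -[] [A B] [/= FA FB] AB.
  apply: filterS FA => x Ax; apply: square_summable_le (ltW e0) _ => n.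
  have c : (fun y : ell2 R => series (fun k => (ell2_seq x - ell2_seq y) k ^+ 2) n)
      @ F --> series (fun k => (ell2_seq x - l) k ^+ 2) n.
    rewrite /series /=; apply: cvg_big => [|k _]; first exact: add_continuous.
    rewrite expr2; under eq_fun do rewrite expr2.
    have ck : (fun y : ell2 R => (ell2_seq x - ell2_seq y) k) @ F -->
        (ell2_seq x - l) k.
      by apply: cvgB; [exact: cvg_cst | exact: coord_cvg].
    exact: cvgM.
  rewrite -(cvg_lim _ c) //; apply: limr_le; first exact: cvgP c.
  apply: filterS FB => y By.
  have /= := AB (x, y) (conj Ax By); rewrite -ball_normE /ball_ /= => xy.
  have := partial_le_ell2_norm n (ell2_seqP (x - y)).
  move=> /le_trans /(_ (ltW xy)).
  by rewrite -[leRHS](ger0_norm (ltW e0)) -sqrtr_sqr ler_sqrt ?sqr_ge0.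
have ls : l \in square_summable.
  have [x [xl _]] := @filter_ex _ F _ _ (near_l 1 ltr01).
  have -> : l = ell2_seq x - (ell2_seq x - l) by rewrite subKr.
  by apply: rpredB => //; exact: ell2_seqP.
apply/cvg_ex; exists (Ell2 ls); apply/cvgrPdist_le => e e0.
near=> x; rewrite distrC.
by have [] : (ell2_seq x - l) \in square_summable /\
    ell2_norm (ell2_seq x - l) <= e by near: x; exact: near_l.
Unshelve. all: by end_near. Qed.

HB.instance Definition _ := Uniform_isComplete.Build (ell2 R) ell2_complete.

End Ell2Banach.

Definition ell2_pos (R : realType) : set (ell2 R) :=
  [set x | forall n, 0 <= x n].

Definition ell2_K (R : realType) : set (ell2 R) :=
  [set x | closed_ball (0 : ell2 R) 1 x /\
           forall n, (1 <= n)%N -> x 0%N + x n ^+ 2 <= 0].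

(* Main.v *)
Require Import Defs.
From mathcomp Require Import all_boot all_order all_algebra.
From mathcomp Require Import boolp classical_sets functions reals ereal.
From mathcomp Require Import topology normedtype sequences.
From mathcomp Require Import ring lra.
Import numFieldNormedType.Exports.
Import Order.TTheory GRing.Theory Num.Theory.
Local Open Scope classical_set_scope.
Local Open Scope ring_scope.

(** Positive and strictly maximal elements are maximal. A nonzero [x] in [K]
    has [x_1 < 0], so if it lies in the open ball some far coordinate can be
    increased without leaving [K]; hence [0] is the only candidate. It is not
    positive, because along [t e_2 - t^2 e_1] in [K] a strictly positive
    functional is positive for small [t]. It is not strictly maximal, because
    [c (e_2 + ... + e_(N+1)) - c^2 e_1] lies in [K], is within [c^2] of the
    cone, and has norm about [1/2] when [N c^2 = 1/4]. *)

(** * Comparison of the three notions in a Banach space *)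

Section Maximality.
Context {R : realType} {X : completeNormedModType R}.
Implicit Types (P K : set X).

Lemma MaxP K P x : P 0 ->
  Max K P x <-> K x /\ forall p, P p -> K (x + p) -> p = 0.
Proof.
move=> P0; split=> -[Kx].
  move=> E; split=> // p Pp Kp.
  have : [set x] (x + p) by rewrite E; split=> //; exists p.
  by move=> /= /(canRL (addKr x)); rewrite addNr.
move=> H; split=> //; apply/seteqP; split=> [y -> | y [Ky [p Pp yE]]].
  by split=> //; exists 0; rewrite ?addr0.
by move: Ky; rewrite -yE => /(H _ Pp) ->; rewrite addr0.
Qed.

(** A nonzero [p] in [P] with [x + p] in [K] would give [f (x + p) > f x], above the supremum of [f]
    on [K]. *)
Lemma Pos_sub_Max K P : P 0 -> Pos K P `<=` Max K P.
Proof.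
move=> P0 x [Kx [f [_ fpos] fx]]; apply/MaxP => //; split=> // p Pp Kp.
apply/eqP/negP => /negP /(fpos _ Pp).
have : ((f (x + p))%:E <= (f x)%:E)%E.
  by rewrite fx; apply: ereal_sup_ubound; exists (x + p).
by rewrite lee_fin raddfD /= gerDl leNgt => /negP.
Qed.

(** If [x + p] lies in [K] for a nonzero [p] in [P], then [p] belongs to both [P + delta B] and
    [K - x] for every [delta], so [eps = |p| / 2] admits no [delta]. *)
Lemma StMax_sub_Max K P : P 0 -> StMax K P `<=` Max K P.
Proof.
move=> P0 x [Kx xst]; apply/MaxP => //; split=> // p Pp Kp.
apply/eqP/negP => /negP pN0.
have np : 0 < `|p| by rewrite normr_gt0.
have np2 : 0 < `|p| / 2 by rewrite divr_gt0.
have [d d0 sub] := xst _ np2.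
have : [set (`|p| / 2) *: b | b in closed_ball (0 : X) 1] p.
  apply: sub; split; last by exists (x + p) => //; rewrite addrC addKr.
  by exists p => //; exists 0; [exact: closed_ballxx | rewrite scaler0 addr0].
move=> [b]; rewrite closed_ballE // /closed_ball_ /= sub0r normrN => b1 bE.
have : `|p| = `|p| / 2 * `|b|.
  by rewrite -[in LHS]bE normrZ ger0_norm // divr_ge0 // ltW.
nra.
Qed.

End Maximality.

(** * Finitely supported vectors of [ell2] *)

Section Ell2.
Context {R : realType}.
Implicit Types (x y : ell2 R) (u : nat -> R).

Lemma finite_support_ell2 u N : (forall n, (N <= n)%N -> u n = 0) ->
  u \in square_summable /\
  ell2_norm u = Num.sqrt (\sum_(0 <= k < N) u k ^+ 2).
Proof.
move=> u0.
have c : series (fun n => u n ^+ 2) @ \oo --> \sum_(0 <= k < N) u k ^+ 2.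
  apply: cvg_near_cst; exists N => // n /= Nn.
  rewrite /series /= (big_cat_nat (leq0n N) Nn) -[RHS]addr0 /=; congr +%R.
  by rewrite big_nat big1 // => k /andP[Nk _]; rewrite u0 // expr0n.
split; first by apply/asboolP; exact: cvgP c.
by rewrite /ell2_norm (cvg_lim _ c).
Qed.

Lemma step_fin_support (c : R) N n :
  (N.+1 <= n)%N -> (if (0 < n <= N)%N then c else 0) = 0.
Proof. by move=> Nn; rewrite [(n <= N)%N]leqNgt Nn andbF. Qed.

(** With coordinates counted from 1 this is c (e_2 + ... + e_(N+1)); coordinate [0] is left free for
    the correction by [- c ^+ 2]. *)
Definition ell2_step (c : R) (N : nat) : ell2 R :=
  Ell2 (proj1 (finite_support_ell2 _ _ (step_fin_support c N))).

Lemma ell2_stepE c N n :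
  ell2_step c N n = if (0 < n <= N)%N then c else 0.
Proof. by []. Qed.

Lemma norm_ell2_step c N : `|ell2_step c N| = Num.sqrt (N%:R * c ^+ 2).
Proof.
rewrite [LHS](proj2 (finite_support_ell2 _ _ (step_fin_support c N))).
congr Num.sqrt; rewrite big_nat_recl //= expr0n add0r.
rewrite (eq_big_nat _ _ (F2 := fun=> c ^+ 2)) => [|k /andP[_ ->] //].
by rewrite sumr_const_nat subn0 mulr_natl.
Qed.

Lemma delta_fin_support i n : (i.+1 <= n)%N -> (n == i)%:R = 0 :> R.
Proof. by move=> lt_in; rewrite gtn_eqF. Qed.

Definition ell2_delta (i : nat) : ell2 R :=
  Ell2 (proj1 (finite_support_ell2 _ _ (delta_fin_support i))).

Lemma ell2_deltaE i n : ell2_delta i n = (n == i)%:R.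
Proof. by []. Qed.

Lemma norm_ell2_delta i : `|ell2_delta i| = 1.
Proof.
rewrite [LHS](proj2 (finite_support_ell2 _ _ (delta_fin_support i))).
rewrite big_nat_recr //= eqxx expr1n big_nat big1 ?add0r ?sqrtr1 //.
by move=> k /andP[_ ki]; rewrite ltn_eqF // expr0n.
Qed.

Lemma ell2_delta_neq0 i : ell2_delta i != 0.
Proof. by rewrite -normr_gt0 norm_ell2_delta. Qed.

Lemma ell2D x y n : (x + y) n = x n + y n. Proof. by []. Qed.
Lemma ell2N x n : (- x) n = - x n. Proof. by []. Qed.
Lemma ell2Z (a : R) x n : (a *: x) n = a * x n. Proof. by []. Qed.
Definition ell2_coordE := (ell2D, ell2N, ell2Z, ell2_deltaE, ell2_stepE).

Lemma ell2P x y : (forall n, x n = y n) -> x = y.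
Proof. by move=> xy; apply/val_inj/funext. Qed.

Lemma le_coord_norm x n : `|x n| <= `|x|.
Proof. exact: le_coord_ell2_norm (ell2_seqP x). Qed.

Lemma sqr_coord_cvg0 x : (fun n => x n ^+ 2) @ \oo --> (0 : R).
Proof. by apply: cvg_series_cvg_0; exact/asboolP/ell2_seqP. Qed.

(** * The set [ell2_K] and its maximal elements *)

Lemma ell2_KP x :
  ell2_K x <-> `|x| <= 1 /\ forall n, (1 <= n)%N -> x 0%N + x n ^+ 2 <= 0.
Proof.
by rewrite /ell2_K closed_ballE // /closed_ball_ /= sub0r normrN.
Qed.

Lemma ell2_K0 : ell2_K (0 : ell2 R).
Proof.
by apply/ell2_KP; rewrite normr0; split=> // n _; rewrite expr0n addr0.
Qed.

Lemma ell2_pos0 : ell2_pos (0 : ell2 R). Proof. by move=> n. Qed.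

(** The constraints force [x 0 <= 0], hence [x 0 = 0], and then every other square is at most 0. *)
Lemma ell2_K_eq0 x : ell2_K x -> 0 <= x 0%N -> x = 0.
Proof.
move=> /ell2_KP[_ Kx] x0; apply: ell2P => -[|n] /=.
  by have := Kx 1%N isT; have := sqr_ge0 (x 1%N); lra.
apply/eqP; rewrite -sqrf_eq0 eq_le sqr_ge0 andbT.
by have := Kx n.+1 isT; lra.
Qed.

Lemma ell2_K_perturb x : ell2_K x -> `|x| < 1 -> x 0%N < 0 ->
  exists n, exists2 e : R, 0 < e & ell2_K (x + e *: ell2_delta n).
Proof.
move=> /ell2_KP[_ Kx] x1 x0.
have a1 : - x 0%N < 1.
  by have := le_coord_norm x 0; have := ler_norm (- x 0%N); rewrite normrN; lra.
have q0 : 0 < - x 0%N / 4 by lra.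
have [N _ HN] := cvgr0_norm_lt _ (sqr_coord_cvg0 x) _ q0.
(* The index [N.+1] is nonzero, so a change there leaves [x 0] alone. *)
have {HN} := HN N.+1 (leqnSn N).
rewrite /= ger0_norm ?sqr_ge0 // => xN.
(* The first bound keeps the perturbed vector in the unit ball; the second, with [- x 0 < 1], yields
   [e ^+ 2 <= - x 0 / 4]. *)
pose e := Num.min (1 - `|x|) (- x 0%N / 2).
have e0 : 0 < e by rewrite lt_min; apply/andP; split; lra.
have e1 : e <= 1 - `|x| by rewrite ge_min lexx.
have e2 : e <= - x 0%N / 2 by rewrite ge_min lexx orbT.
exists N.+1, e => //; apply/ell2_KP; split.
  apply: le_trans (ler_normD _ _) _.
  by rewrite normrZ norm_ell2_delta gtr0_norm //; lra.
move=> n n1; rewrite !ell2_coordE /= mulr0 addr0.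
have [->|_] := eqVneq n N.+1; last by rewrite mulr0 addr0; exact: Kx.
(* This square bounds [(x N.+1 + e) ^+ 2] by twice the sum of the two squares, each at most
   [- x 0 / 4]. *)
rewrite mulr1; have := sqr_ge0 (x N.+1 - e).
have : e ^+ 2 <= - x 0%N / 4 by nra.
lra.
Qed.

Lemma Max_ell2_K0 : Max (@ell2_K R) (@ell2_pos R) 0.
Proof.
apply/MaxP; first exact: ell2_pos0.
split=> [|p p0]; first exact: ell2_K0.
by rewrite add0r => /ell2_K_eq0; apply; exact: p0.
Qed.

Lemma Max_ell2_K_eq0 x : `|x| < 1 ->
  Max (@ell2_K R) (@ell2_pos R) x -> x = 0.
Proof.
move=> x1 /(MaxP _ _ _ ell2_pos0)[Kx xmax].
have [x0|x0] := leP 0 (x 0%N); first exact: ell2_K_eq0.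
have [n [e e0 Kxe]] := ell2_K_perturb _ Kx x1 x0.
have /eqP : e *: ell2_delta n = 0.
  by apply: xmax => // k; rewrite !ell2_coordE mulr_ge0 // ltW.
by rewrite scaler_eq0 gt_eqF // (negPf (ell2_delta_neq0 n)).
Qed.

(** * Failure of positivity and strict maximality at the origin *)

Lemma not_Pos_ell2_K0 : ~ Pos (@ell2_K R) (@ell2_pos R) 0.
Proof.
move=> [_ [f [_ fpos] f0]].
have fd i : 0 < f (ell2_delta i).
  by apply: fpos (ell2_delta_neq0 i) => n; rewrite ell2_deltaE.
set a := f (ell2_delta 0); set b := f (ell2_delta 1).
have a0 : 0 < a := fd _; have b0 : 0 < b := fd _.
(* The bound [1 / 2] gives [|y| <= t + t ^+ 2 <= 1]; the other gives
   [f y = t * (b - t * a) >= t * b / 2 > 0]. *)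
pose t := Num.min (1 / 2) (b / (2 * a)).
have t0 : 0 < t by rewrite lt_min !divr_gt0 // mulr_gt0.
have t1 : t <= 1 / 2 by rewrite ge_min lexx.
have t2 : t * a <= b / 2.
  have : t <= b / (2 * a) by rewrite ge_min lexx orbT.
  by rewrite ler_pdivlMr ?mulr_gt0 // => h; lra.
pose y := t *: ell2_delta 1 - t ^+ 2 *: ell2_delta 0.
have Ky : ell2_K y.
  apply/ell2_KP; split.
    apply: le_trans (ler_normB _ _) _; rewrite !normrZ !norm_ell2_delta.
    by rewrite !ger0_norm ?sqr_ge0 ?(ltW t0) //; nra.
  move=> [//|[|n]] _; rewrite !ell2_coordE /=; nra.
have : ((f y)%:E <= (f 0)%:E)%E.
  by rewrite f0; apply: ereal_sup_ubound; exists y.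
rewrite lee_fin raddf0 raddfB /= !linearZ /= -/a -/b leNgt => /negP; apply.
rewrite /GRing.scale /=; nra.
Qed.

Lemma not_StMax_ell2_K0 : ~ StMax (@ell2_K R) (@ell2_pos R) 0.
Proof.
move=> [_ st].
have e0 : 0 < 1 / 8 :> R by rewrite divr_gt0.
have [d d0 sub] := st _ e0.
(* Taking a perfect square [m ^ 2] of coordinates equal to [c = 1 / (2 m)] makes the norm of [p]
   exactly [1 / 2], while [m > 1 / d] makes [c ^+ 2 <= d]. *)
pose m := (Num.truncn d^-1).+1.
have m1 : 1 <= m%:R :> R by rewrite ler1n.
have dm : d^-1 < m%:R by rewrite truncnS_gt.
pose c : R := (2 * m%:R)^-1.
have mc : m%:R * c = 1 / 2 by rewrite /c; field; lra.
have c0 : 0 < c by rewrite invr_gt0; lra.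
have c12 : c <= 1 / 2 by nra.
have cd : c ^+ 2 <= d.
  have : 1 < m%:R * d by rewrite -ltr_pdivrMr // div1r.
  nra.
pose p := ell2_step c (m ^ 2).
have np : `|p| = 1 / 2.
  by rewrite norm_ell2_step natrX -exprMn sqrtr_sqr mc ger0_norm //; lra.
pose y := p - c ^+ 2 *: ell2_delta 0.
have nc : `|c ^+ 2 *: ell2_delta 0| = c ^+ 2.
  by rewrite normrZ norm_ell2_delta mulr1 ger0_norm ?sqr_ge0.
have Ky : ell2_K y.
  apply/ell2_KP; split.
    by apply: le_trans (ler_normB _ _) _; rewrite np nc; nra.
  move=> [//|n] _; rewrite !ell2_coordE /=.
  by case: ifP => _; nra.
have : [set (1 / 8) *: b | b in closed_ball (0 : ell2 R) 1] y.
  apply: sub; split; last by exists y => //; rewrite subr0.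
  exists p.
    by move=> n; rewrite ell2_stepE; case: ifP => _; [exact: ltW | exact: lexx].
  (* Scaled by [d], this vector is the correction [y - p]; it lies in the unit ball because
     [c ^+ 2 <= d]. *)
  exists (- (c ^+ 2 / d) *: ell2_delta 0).
    rewrite closed_ballE // /closed_ball_ /= sub0r normrN normrZ normrN.
    rewrite norm_ell2_delta mulr1 ger0_norm.
      by rewrite ler_pdivrMr // mul1r.
    by apply: divr_ge0; [exact: sqr_ge0 | exact: ltW].
  by rewrite scalerA mulrN mulrC divfK ?gt_eqF // scaleNr.
move=> [b]; rewrite closed_ballE // /closed_ball_ /= sub0r normrN => b1 bE.
have : `|y| <= 1 / 8.
  by rewrite -bE normrZ ger0_norm; lra.
(* Contradiction: [1 / 2 = |p| <= |y| + c ^+ 2 <= 1 / 8 + 1 / 4]. *)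
have := ler_normD y (c ^+ 2 *: ell2_delta 0); rewrite subrK np nc; nra.
Qed.

End Ell2.

Theorem proposition3p7 (R : realType) :
  let U := ball (0 : ell2 R) 1 in
  let K := @ell2_K R in
  let P := @ell2_pos R in
  Max K P `&` U = [set (0 : ell2 R)] /\
  StMax K P `&` U = Pos K P `&` U /\
  Pos K P `&` U = set0.
Proof.
move=> U K P.
have UE x : U x = (`|x| < 1) :> Prop.
  by rewrite /U -ball_normE /ball_ /= sub0r normrN.
have Max0 x : Max K P x -> U x -> x = 0.
  by rewrite UE => xmax x1; exact: Max_ell2_K_eq0.
have Pos0 : Pos K P `&` U = set0.
  rewrite -subset0 => x [xpos Ux]; move: (xpos).
  rewrite (Max0 x) //; last exact: Pos_sub_Max ell2_pos0 _ xpos.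
  exact: not_Pos_ell2_K0.
have StMax0 : StMax K P `&` U = set0.
  rewrite -subset0 => x [xst Ux]; move: (xst).
  rewrite (Max0 x) //; last exact: StMax_sub_Max ell2_pos0 _ xst.
  exact: not_StMax_ell2_K0.
split; last by rewrite Pos0 StMax0.
apply/seteqP; split=> [x [xmax Ux] | x ->]; first exact: Max0.
by split; [exact: Max_ell2_K0 | rewrite UE normr0].
Qed.
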